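(* Let $d\ge1$, $r\in(0,+\infty)$, let $\|\cdot\|$ be a norm on $\mathbb{R}^d$, and let $P$ be a Borel probability measure on $\mathbb{R}^d$ with $\int\|x\|^r\,dP(x)<+\infty$. Let $s\in(r,d+r)$ and let $(a_n)_{n\ge1}$ be an $L^r$-optimal greedy quantization sequence for $P$, $a^{(n)}=\{a_1,\dots,a_n\}$. Let $\varepsilon\in(0,\tfrac13)$, let $\nu$ be a probability distribution on $\mathbb{R}^d$ and $g_\varepsilon:\mathbb{R}^d\to\mathbb{R}_+$ a Borel function such that for every $x\in\operatorname{supp}(P)$ and every $t\in[0,\varepsilon\|x-a_1\|]$, $\nu(B(x,t))\ge g_\varepsilon(x)V_dt^d$. Then for every $n\ge3$, $$e_s(a^{(n)},P)\le\kappa^{\mathrm{Greedy}}_{d,r,\varepsilon}\Big(\int g_\varepsilon^{-\frac{s}{d+r-s}}dP\Big)^{\frac{d+r-s}{s(d+r)}}\Big(\int g_\varepsilon^{-\frac rd}dP\Big)^{\frac1{d+r}}(n-2)^{-\frac1d},$$ where $\kappa^{\mathrm{Greedy}}_{d,r,\varepsilon}=2^{\frac1d}\big(\frac rd\big)^{\frac{r}{d(d+r)}}V_d^{-\frac1d}\varphi_r(\varepsilon)^{-\frac1d}$.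
   Context: For a finite nonempty $\Gamma\subset\mathbb{R}^d$ and $p>0$, $d(x,\Gamma)=\min_{a\in\Gamma}\|x-a\|$ and $e_p(\Gamma,P)=\big(\int d(x,\Gamma)^p dP(x)\big)^{1/p}$. An $L^r$-optimal greedy quantization sequence for $P$ is a sequence $(a_n)_{n\ge1}$ with $a_{n+1}\in\operatorname{argmin}_{\xi\in\mathbb{R}^d}e_r(a^{(n)}\cup\{\xi\},P)$ for all $n\ge0$, where $a^{(0)}=\varnothing$ and $a^{(n)}=\{a_1,\dots,a_n\}$ (so $a_1$ is an $L^r$-median of $P$). $B(x,t)=\{y:\|y-x\|\le t\}$, $V_d=\lambda_d(B(0,1))$ with $\lambda_d$ Lebesgue measure, $\varphi_r(u)=(3^{-r}-u^r)u^d$. *)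

(* Defs.v *)
(* R^d is modelled as d.-tuple R (which carries the
   product = Borel sigma-algebra of the library), with an ARBITRARY norm N. *)
From HB Require Import structures.
From mathcomp Require Import all_boot all_order all_algebra.
From mathcomp Require Import all_classical all_reals all_analysis.
Set Implicit Arguments. Unset Strict Implicit. Unset Printing Implicit Defensive.
Import Order.TTheory GRing.Theory Num.Theory.
Local Open Scope classical_set_scope.
Local Open Scope ring_scope.

Section Defs.
Variable R : realType.

Definition vsub (d : nat) (x y : d.-tuple R) : d.-tuple R :=
  [tuple tnth x i - tnth y i | i < d].
Definition vadd (d : nat) (x y : d.-tuple R) : d.-tuple R :=
  [tuple tnth x i + tnth y i | i < d].
Definition vscale (d : nat) (a : R) (x : d.-tuple R) : d.-tuple R :=
  [tuple a * tnth x i | i < d].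
Definition vzero (d : nat) : d.-tuple R := [tuple 0 | i < d].

Definition is_norm (d : nat) (N : d.-tuple R -> R) : Prop :=
  [/\ forall x, N x = 0 -> x = vzero d,
      forall a x, N (vscale a x) = `|a| * N x &
      forall x y, N (vadd x y) <= N x + N y].

Definition ball_N (d : nat) (N : d.-tuple R -> R) (x : d.-tuple R) (t : R)
  : set (d.-tuple R) := [set y | N (vsub y x) <= t].

Definition dist_to (d : nat) (N : d.-tuple R -> R) (x : d.-tuple R)
  (G : seq (d.-tuple R)) : R :=
  match G with
  | [::] => 0 (* never used: Gamma is always nonempty below *)
  | b :: G' => foldr (fun c m => Num.min (N (vsub x c)) m) (N (vsub x b)) G'
  end.

Definition quant_err (d : nat) (N : d.-tuple R -> R) (P : probability (d.-tuple R) R)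
  (p : R) (G : seq (d.-tuple R)) : \bar R :=
  ((\int[P]_x ((dist_to N x G) `^ p)%:E) `^ (p^-1))%E.

(* a^{(n)} = {a_1, ..., a_n}   (the sequence is indexed from 1; a 0 is unused) *)
Definition first_pts (d : nat) (a : nat -> d.-tuple R) (n : nat) : seq (d.-tuple R) :=
  [seq a k | k <- iota 1 n].

Definition greedy_seq (d : nat) (N : d.-tuple R -> R) (P : probability (d.-tuple R) R)
  (r : R) (a : nat -> d.-tuple R) : Prop :=
  forall (n : nat) (xi : d.-tuple R),
    (quant_err N P r (a n.+1 :: first_pts a n) <= quant_err N P r (xi :: first_pts a n))%E.

Definition supp (d : nat) (N : d.-tuple R -> R) (mu : probability (d.-tuple R) R)
  : set (d.-tuple R) :=
  [set x | forall t : R, 0 < t -> (0 < mu (ball_N N x t))%E].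

(* Lebesgue integral on R^d of a nonnegative function, as the iterated
   integral w.r.t. the Lebesgue measure on R (equal to the integral against
   lambda_d for Borel f, by Tonelli). *)
Fixpoint leb_iter (d : nat) : (d.-tuple R -> \bar R) -> \bar R :=
  match d return (d.-tuple R -> \bar R) -> \bar R with
  | 0 => fun f => f [tuple]
  | d'.+1 => fun f =>
      (\int[@lebesgue_measure R]_x leb_iter (fun t : d'.-tuple R => f (cons_tuple x t)))%E
  end.

Definition unit_ball_vol (d : nat) (N : d.-tuple R -> R) : \bar R :=
  leb_iter (fun x : d.-tuple R => if N x <= 1 then 1%E else 0%E).

Definition phi_r (d : nat) (r u : R) : R := (3 `^ (- r) - u `^ r) * u ^+ d.

Definition kappa_greedy (d : nat) (N : d.-tuple R -> R) (r eps : R) : R :=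
  2 `^ (d%:R^-1) * (r / d%:R) `^ (r / (d%:R * (d%:R + r)))
  * (fine (unit_ball_vol N)) `^ (- d%:R^-1) * (phi_r d r eps) `^ (- d%:R^-1).

(* g^{-a} as an extended real, with the convention 0^{-a} = +oo (a > 0) *)
Definition neg_pow (g : R) (a : R) : \bar R :=
  if g == 0 then +oo%E else (g `^ (- a))%:E.

End Defs.

(* Main.v *)
Require Import Defs.
From HB Require Import structures.
From mathcomp Require Import all_boot all_order all_algebra.
From mathcomp Require Import all_classical all_reals all_analysis.
From mathcomp.analysis Require Import measurable_realfun.
From mathcomp Require Import ring lra zify.
Import Order.TTheory GRing.Theory Num.Theory.
Import numFieldNormedType.Exports.
Local Open Scope classical_set_scope.
Local Open Scope ring_scope.

Set Implicit Arguments.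
Unset Strict Implicit.
Unset Printing Implicit Defensive.

(** Let D_n(x) be the distance from x to a^(n) and u_n = int D_n^r dP. By optimality of
    a_(n+1), adding any other point y instead gains at most u_n - u_(n+1). Averaging this
    over y ~ nu and applying Tonelli, each x contributes at least
    (1 - eps^r) D_n(x)^r nu(B(x, eps D_n(x))), because a point y of that ball brings the
    distance from D_n(x) down to eps D_n(x). The hypothesis on nu yields
      u_n - u_(n+1) >= V_d phi_r(eps) int g D_n^(d+r) dP.
    Hoelder's inequality bounds the right-hand side from below by a multiple of
    (int D_n^p dP)^((d+r)/p), for p = r and for p = s. With p = r this is a recursion
    u_(n+1) <= u_n - c u_n^(1+d/r), hence u_n = O(n^(-r/d)); with p = s, summing over the
    second half of the indices bounds e_s(a^(n)) by u at the midpoint.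
    For kappa not to degenerate, the volume of the unit ball must be positive and finite:
    this is the equivalence of N with the sup norm. *)

(** * Norms on R^d and their equivalence with the sup norm *)

Section NormBasics.
Context {R : realType} {d : nat} {N : d.-tuple R -> R} (normN : is_norm N).

Lemma norm_scale a x : N (vscale a x) = `|a| * N x.
Proof. by case: normN. Qed.

Lemma norm_triangle x y : N (vadd x y) <= N x + N y.
Proof. by case: normN. Qed.

Lemma norm_vzero : N (vzero R d) = 0.
Proof.
rewrite [vzero R d](_ : _ = vscale 0 (vzero R d)) ?norm_scale ?normr0 ?mul0r//.
by apply: eq_from_tnth => i; rewrite !tnth_mktuple mul0r.
Qed.

Lemma norm_ge0 x : 0 <= N x.
Proof.
have := norm_triangle x (vscale (-1) x).
rewrite norm_scale normrN1 mul1r [vadd _ _](_ : _ = vzero R d).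
  by rewrite norm_vzero; lra.
by apply: eq_from_tnth => i; rewrite !tnth_mktuple mulN1r subrr.
Qed.

Lemma norm_vsubC x y : N (vsub x y) = N (vsub y x).
Proof.
rewrite [vsub x y](_ : _ = vscale (-1) (vsub y x)).
  by rewrite norm_scale normrN1 mul1r.
by apply: eq_from_tnth => i; rewrite !tnth_mktuple mulN1r opprB.
Qed.

Lemma norm_vsub_triangle y x z : N (vsub x z) <= N (vsub x y) + N (vsub y z).
Proof.
rewrite [vsub x z](_ : _ = vadd (vsub x y) (vsub y z)) ?norm_triangle//.
by apply: eq_from_tnth => i; rewrite !tnth_mktuple addrA subrK.
Qed.

Lemma norm_le_vsub x y : N x <= N y + N (vsub x y).
Proof.
rewrite {1}[x](_ : _ = vadd y (vsub x y)) ?norm_triangle//.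
by apply: eq_from_tnth => i; rewrite !tnth_mktuple addrC subrK.
Qed.

(** Row vectors carry the sup norm and its topology, where compactness and the extreme value theorem
    apply; [M] below is [N] transported to them. *)
Let tup (v : 'rV[R]_d) : d.-tuple R := [tuple v 0 i | i < d].
Let row (x : d.-tuple R) : 'rV[R]_d := \row_i tnth x i.

Let rowK x : tup (row x) = x.
Proof. by apply: eq_from_tnth => i; rewrite tnth_mktuple mxE. Qed.

Let M v := N (tup v).

Let MD u v : M (u + v) <= M u + M v.
Proof.
rewrite /M [tup (u + v)](_ : _ = vadd (tup u) (tup v)) ?norm_triangle//.
by apply: eq_from_tnth => i; rewrite !tnth_mktuple mxE.
Qed.

Let MZ a v : M (a *: v) = `|a| * M v.
Proof.
rewrite /M [tup (a *: v)](_ : _ = vscale a (tup v)) ?norm_scale//.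
by apply: eq_from_tnth => i; rewrite !tnth_mktuple mxE.
Qed.

Let M0 : M 0 = 0.
Proof. by rewrite -(scale0r 0) MZ normr0 mul0r. Qed.

Let coord_le_norm (v : 'rV[R]_d) i : `|v 0 i| <= `|v|.
Proof.
rewrite [leRHS]/Num.Def.normr/= mx_normrE.
by apply/bigmax_geP; right => /=; exists (0, i).
Qed.

Let M_le_coord (v : 'rV[R]_d) t : (forall i, `|v 0 i| <= t) ->
  M v <= t * \sum_i M (delta_mx 0 i).
Proof.
move=> vt; rewrite {1}(row_sum_delta v).
rewrite mulr_sumr; elim/big_ind2 : _ => [|x1 x2 y1 y2 h1 h2|i _].
- by rewrite M0.
- by rewrite (le_trans (MD _ _))// lerD.
- by rewrite MZ ler_wpM2r// norm_ge0.
Qed.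

Lemma norm_le_coord : exists2 C, 0 < C &
  forall x t, (forall i, `|tnth x i| <= t) -> 0 <= t -> N x <= C * t.
Proof.
have S0 : 0 <= \sum_i M (delta_mx 0 i) by apply: sumr_ge0 => i _; exact: norm_ge0.
(* The [+ 1] keeps the constant positive even for [d = 0], where the sum is empty. *)
exists (\sum_i M (delta_mx 0 i) + 1); first by rewrite ltr_wpDl.
move=> x t xt t0; rewrite -[x in N x]rowK.
have /M_le_coord/le_trans->// : forall i, `|row x 0 i| <= t by move=> i; rewrite mxE.
by rewrite mulrC ler_wpM2r// lerDl.
Qed.

Let M_continuous : continuous M.
Proof.
move=> v; apply/(@cvgrPdist_lt R R^o _ (nbhs v) (nbhs_filter v)) => e e0.
apply/(@nbhs_normP R 'rV[R]_d v).
have S0 : 0 < \sum_i M (delta_mx 0 i) + 1.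
  by rewrite ltr_wpDl// sumr_ge0// => i _; exact: norm_ge0.
have lip u w : M u - M w <= `|u - w| * \sum_i M (delta_mx 0 i).
  rewrite lerBlDl -{1}(subrK w u) addrC (le_trans (MD _ _))// lerD2l.
  exact/M_le_coord/coord_le_norm.
exists (e / (\sum_i M (delta_mx 0 i) + 1)) => /= [|u uv]; first by rewrite divr_gt0.
rewrite (@le_lt_trans _ _ (`|v - u| * (\sum_i M (delta_mx 0 i) + 1)))//.
  rewrite ler_norml; apply/andP; split.
    rewrite lerNl opprB (le_trans (lip _ _))// distrC ler_wpM2l//.
    by rewrite lerDl.
  by rewrite (le_trans (lip _ _))// ler_wpM2l// lerDl.
by rewrite -ltr_pdivlMr.
Qed.

(* Compactness of the unit sphere of the sup norm gives the constant. *)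
Lemma coord_le_norm_tuple : exists2 c, 0 < c &
  forall x i, c * `|tnth x i| <= N x.
Proof.
(* For [d = 0] the unit sphere is empty and offers no minimum, but there is no coordinate to bound
   either. *)
have [d0|d0] := posnP d.
  by exists 1 => // x i; exfalso; move: (ltn_ord i); rewrite {2}d0.
pose S := [set v : 'rV[R]_d | `|v| = 1].
have cS : compact S.
  apply: bounded_closed_compact.
    by exists 1; split => // e e1 v /= ->; exact: ltW.
  apply: (@preimage_closed _ _ (fun v : 'rV[R]_d => `|v|) [set x | x = 1]).
    by move=> v _; exact: norm_continuous.
  exact: closed_eq.
have S0 : S !=set0.
  exists (const_mx 1); rewrite /S /= /Num.Def.normr/= mx_normrE; apply/eqP.
  rewrite eq_le; apply/andP; split.
    by apply: bigmax_le => // -[i j] _; rewrite mxE normr1.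
  by apply/bigmax_geP; right => /=; exists (0, Ordinal d0); rewrite // mxE normr1.
have cM : {within S, continuous M} by apply: continuous_subspaceT.
have [v0 v0S v0min] := EVT_min_rV S0 cS cM.
exists (M v0).
  rewrite lt_neqAle norm_ge0 andbT eq_sym; apply/negP => /eqP Mv0.
  have v00 : v0 = 0.
    case: normN => /(_ (tup v0) Mv0) + _ _ => v00; apply/rowP => i.
    by move/(congr1 (fun t => tnth t i)): v00; rewrite !tnth_mktuple mxE.
  by move: v0S; rewrite inE /S/= v00 normr0 => /eqP; rewrite eq_sym oner_eq0.
move=> x i; rewrite -{2}(rowK x) -/(M _).
have := coord_le_norm (row x) i; rewrite mxE => xi.
have [r0|r0] := eqVneq `|row x| 0.
  by rewrite (le_trans (ler_wpM2l _ xi)) ?norm_ge0// r0 mulr0 norm_ge0.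
have rp : 0 < `|row x| by rewrite lt_neqAle eq_sym r0 normr_ge0.
rewrite (le_trans (ler_wpM2l _ xi)) ?norm_ge0//.
have := v0min (`|row x|^-1 *: row x).
rewrite inE /S/= normrZ normfV normr_id mulVf// => /(_ erefl).
by rewrite MZ normfV normr_id mulrC ler_pdivlMr.
Qed.

End NormBasics.

(** * Rational points, Borel measurability of the norm, negligibility off the support *)

Lemma rational_dense (R : realType) (d : nat) (x : d.-tuple R) (e : R) : 0 < e ->
  exists q : d.-tuple rat, forall i, `|tnth x i - ratr (tnth q i)| <= e.
Proof.
move=> e0.
have /choice[q qP] : forall i, exists q : rat, `|tnth x i - ratr q| <= e.
  move=> i; have /rat_in_itvoo[q] : tnth x i - e < tnth x i + e by lra.
  rewrite in_itv/= => /andP[q1 q2]; exists q; rewrite ler_norml; lra.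
by exists [tuple q i | i < d] => i; rewrite tnth_mktuple.
Qed.

Definition vrat (R : realType) (d : nat) (q : d.-tuple rat) : d.-tuple R :=
  [tuple ratr (tnth q i) | i < d].

Section NormMeasurability.
Context {R : realType} {d : nat} {N : d.-tuple R -> R} (normN : is_norm N).

Lemma norm_rational_dense x e : 0 < e -> exists q, N (vsub x (vrat R q)) < e.
Proof.
move=> e0; have [C C0 NC] := norm_le_coord normN.
have e2 : 0 < e / (2 * C) by rewrite divr_gt0// mulr_gt0.
have [q qP] := rational_dense x e2; exists q.
apply: (@le_lt_trans _ _ (C * (e / (2 * C)))).
  by apply: NC (ltW e2) => i; rewrite !tnth_mktuple.
by rewrite (_ : C * (e / (2 * C)) = e / 2); [lra|field; rewrite gt_eqF].
Qed.

(* The rational cubes [|x_i - q_i| <= e] on which the Lipschitz bound keeps N below y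
   exhaust the open sublevel set. *)
Lemma measurable_norm : measurable_fun [set: d.-tuple R] N.
Proof.
have [C C0 NC] := norm_le_coord normN.
move=> mD; apply: (measurability _ (measurable_realfun.RGenInftyO.measurableE R)) => //.
move=> _ [_ [y ->] <-]; rewrite setTI.
pose F (p : d.-tuple rat * nat) : set (d.-tuple R) :=
  if N (vrat R p.1) + C * p.2.+1%:R^-1 < y then
    [set x | forall i, `|tnth x i - ratr (tnth p.1 i)| <= p.2.+1%:R^-1] else set0.
rewrite [X in measurable X](_ : _ = \bigcup_p F p).
  apply: countable_bigcupT_measurable => // -[q k]; rewrite /F; case: ifP => // _.
  rewrite [X in measurable X](_ : _ = \bigcap_(i in [set: 'I_d])
    [set x | `|tnth x i - ratr (tnth q i)| <= k.+1%:R^-1]); last first.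
    by apply/seteqP; split => x /=; [move=> h i _; exact: h|move=> h i; exact: h].
  apply: fin_bigcap_measurable => // i _.
  rewrite -[X in measurable X]setTI.
  have := @measurable_fun_ler _ (d.-tuple R) R setT
    (fun x => `|tnth x i - ratr (tnth q i)|) (cst k.+1%:R^-1).
  move=> /(_ _ _ measurableT [set true]); apply => //.
  apply: measurableT_comp => //; apply: measurable_funB => //.
  exact: measurable_tnth.
apply/seteqP; split => x /=.
- rewrite in_itv/= => xy.
  (* The factor 2 pays for [C / (k+1)] twice: for moving from [x] to the rational centre, and for
     the margin in the test of [F]. *)
  have [k kP] : exists k : nat, k.+1%:R^-1 < (y - N x) / (2 * C).
    have e0 : 0 < (y - N x) / (2 * C) by rewrite divr_gt0 ?mulr_gt0 ?subr_gt0.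
    by have [k kP] := ltr_add_invr e0; exists k; rewrite add0r in kP.
  have k0 : 0 < k.+1%:R^-1 :> R by rewrite invr_gt0.
  have [q qP] := rational_dense x k0.
  exists (q, k) => //; rewrite /F/=; case: ifPn => // /negP[].
  have xq : N (vsub (vrat R q) x) <= C * k.+1%:R^-1.
    apply: NC (ltW k0) => i; rewrite !tnth_mktuple distrC; exact: qP.
  apply: (@le_lt_trans _ _ (N x + C * k.+1%:R^-1 * 2)).
    rewrite mulr2n mulrDr mulr1 addrA lerD2r.
    by rewrite (le_trans (norm_le_vsub normN (vrat R q) x))// lerD2l.
  by move: kP; rewrite ltr_pdivlMr ?mulr_gt0// ltrBrDl mulrCA mulrC (mulrC C).
- move=> [[q k] _]; rewrite /F/=; case: ifPn => // qy xq; rewrite in_itv/=.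
  apply: le_lt_trans qy; rewrite (le_trans (norm_le_vsub normN x (vrat R q)))//.
  rewrite lerD2l; apply: NC => // i; rewrite !tnth_mktuple; exact: xq.
Qed.


Lemma measurable_norm_vsub : measurable_fun [set: d.-tuple R * d.-tuple R]
  (fun z => N (vsub z.1 z.2)).
Proof.
apply: (measurableT_comp measurable_norm); apply/measurable_fun_tnthP => i.
rewrite [_ \o _](_ : _ = fun z => tnth z.1 i - tnth z.2 i); last first.
  by apply/funext => z /=; rewrite tnth_mktuple.
by apply: measurable_funB; apply: (measurableT_comp (measurable_tnth i)).
Qed.

Lemma measurable_norm_vsubr b : measurable_fun [set: d.-tuple R]
  (fun x => N (vsub x b)).
Proof. exact: (measurable_comp _ _ measurable_norm_vsub (measurable_pair2 b)). Qed.

Lemma measurable_ball_N x t : measurable (ball_N N x t).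
Proof.
rewrite -[X in measurable X]setTI.
have := measurable_fun_ler (measurable_norm_vsubr x) (measurable_cst t).
by move=> /(_ measurableT [set true]); apply.
Qed.

(* Every point outside the support lies in one of the countably many null balls with
   rational centre and radius 1/(k+1). *)
Lemma negligible_suppC (P : probability (d.-tuple R) R) :
  P.-negligible (~` supp N P).
Proof.
pose B (p : d.-tuple rat * nat) := ball_N N (vrat R p.1) p.2.+1%:R^-1.
pose F (p : d.-tuple rat * nat) := if P (B p) == 0%E then B p else set0.
have nF p : P.-negligible (F p).
  rewrite /F; case: ifPn => [/eqP PB|_]; last exact: negligible_set0.
  by exists (B p); split => //; exact: measurable_ball_N.
apply: (@negligibleS _ _ _ _ (\bigcup_n oapp F set0 (unpickle n))); last first.
  apply: negligible_bigcup => n; case: (unpickle n) => [p|]; first exact: nF.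
  exact: negligible_set0.
move=> x /existsNP[t /not_implyP[t0 /negP]]; rewrite -leNgt => Pt.
(* With a radius below [t / 2], the ball around a rational point that close to [x] stays inside
   [ball_N N x t], hence is null. *)
have [k] := ltr_add_invr (divr_gt0 t0 (@ltr0Sn R 1)); rewrite add0r => kt.
have k0 : 0 < k.+1%:R^-1 :> R by rewrite invr_gt0.
have [q qx] := norm_rational_dense x k0.
exists (pickle (q, k)) => //; rewrite pickleK /= /F ifT /B /ball_N /=; first exact: ltW.
rewrite -measure_le0 (le_trans _ Pt)// le_measure ?inE//; try exact: measurable_ball_N.
move=> y; rewrite /ball_N/= => yq.
have := norm_vsub_triangle normN (vrat R q) y x.
rewrite (norm_vsubC normN (vrat R q) x).
by move: kt qx yq; move: k.+1%:R^-1 => u; lra.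
Qed.

End NormMeasurability.

(** * Iterated Lebesgue integrals and the volume of the unit ball *)

(** The integral of a nonnegative function is a supremum over the simple functions below it, so
    monotonicity is an inclusion of index sets. Iterated integrals can thus be compared without
    first proving the inner ones measurable. *)
Lemma ge0_le_integral_nomeas (disp : measure_display) (T : measurableType disp)
  (R : realType) (mu : {measure set T -> \bar R}) (f g : T -> \bar R) :
  (forall x, 0 <= f x)%E -> (forall x, f x <= g x)%E ->
  (\int[mu]_x f x <= \int[mu]_x g x)%E.
Proof.
move=> f0 fg; rewrite !ge0_integralTE//; last by move=> x; exact: le_trans (fg x).
apply: le_ereal_sup => _ [h hf <-]; exists h => // x.
exact: le_trans (hf x) (fg x).
Qed.

Section Volume.
Context {R : realType}.

Lemma leb_iter_ge0 d (f : d.-tuple R -> \bar R) : (forall x, 0 <= f x)%E ->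
  (0 <= leb_iter f)%E.
Proof.
elim: d f => [|d IHd] f f0 /=; first exact: f0.
by apply: integral_ge0 => x _; apply: IHd.
Qed.

Lemma le_leb_iter d (f g : d.-tuple R -> \bar R) : (forall x, 0 <= f x)%E ->
  (forall x, f x <= g x)%E -> (leb_iter f <= leb_iter g)%E.
Proof.
elim: d f g => [|d IHd] f g f0 fg /=; first exact: fg.
by apply: ge0_le_integral_nomeas => x; [exact: leb_iter_ge0|exact: IHd].
Qed.

Lemma leb_iter0 d : leb_iter (fun _ : d.-tuple R => 0%E) = 0%E.
Proof. by elim: d => //= d ->; exact: integral0. Qed.

Lemma leb_iter_cube d (M : R) : 0 <= M ->
  leb_iter (fun x : d.-tuple R => if all (fun u => `|u| <= M) x then 1%E else 0%E) =
  ((2 * M) ^+ d)%:E.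
Proof.
move=> M0; elim: d => [|d IHd] /=; first by rewrite expr0.
transitivity (\int[@lebesgue_measure R]_x (((2 * M) ^+ d)%:E * (\1_(`[- M, M]) x)%:E))%E.
  apply: eq_integral => x _; rewrite indicE mem_setE in_itv/= -ler_norml.
  by case: (`|x| <= M) => /=; rewrite ?mule1 ?mule0 ?IHd ?leb_iter0.
rewrite ge0_integralZl//; last 2 first.
- exact/measurable_EFinP.
- by rewrite lee_fin exprn_ge0// mulr_ge0.
rewrite integral_indic// setIT -[X in (_ * X)%E]/(lebesgue_measure `[- M, M]%classic).
rewrite lebesgue_measure_itv /=.
case: ifPn => [_|]; first by rewrite -EFinB -EFinM exprSr; congr (_ * _)%:E; ring.
(* The interval is degenerate; both sides vanish, the exponent on the right being [d.+1]. *)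
rewrite lte_fin -leNgt => MM; have -> : M = 0 by lra.
by rewrite mulr0 exprS mul0r mule0.
Qed.

(** Equivalence of norms places the unit ball between two cubes. The outer cube matters for
    positivity as well, since [fine] sends an infinite volume to 0. *)
Lemma unit_ball_vol_gt0 d (N : d.-tuple R -> R) : is_norm N ->
  0 < fine (unit_ball_vol N).
Proof.
move=> normN.
have [C C0 NC] := norm_le_coord normN.
have [c c0 Nc] := coord_le_norm_tuple normN.
have lb : (((2 * C^-1) ^+ d)%:E <= unit_ball_vol N)%E.
  rewrite -leb_iter_cube ?invr_ge0 ?(ltW C0)// /unit_ball_vol.
  apply: le_leb_iter => x; first by case: ifP.
  case: ifP => //.
    move=> /all_tnthP xC; rewrite ifT//.
    by rewrite (le_trans (NC _ _ xC _))// ?invr_ge0 ?(ltW C0)// divff// gt_eqF.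
  by move=> _; case: ifP.
have ub : (unit_ball_vol N <= ((2 * c^-1) ^+ d)%:E)%E.
  rewrite -leb_iter_cube ?invr_ge0 ?(ltW c0)// /unit_ball_vol.
  apply: le_leb_iter => x; first by case: ifP.
  case: ifP => //.
    move=> Nx; rewrite ifT//; apply/all_tnthP => i.
    by rewrite -[leRHS]mul1r ler_pdivlMr// mulrC (le_trans (Nc _ _)).
  by move=> _; case: ifP.
apply: fine_gt0; rewrite (le_lt_trans ub) ?ltry// andbT (lt_le_trans _ lb)//.
by rewrite lte_fin exprn_gt0// mulr_gt0// invr_gt0.
Qed.

End Volume.

(** * Constants under a probability, and the distance to a finite set *)

Lemma integral_cst_probability (disp : measure_display) (T : measurableType disp)
  (R : realType) (P : probability T R) (c : \bar R) : (\int[P]_x c = c)%E.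
Proof.
have PT : P [set: T] = 1%E by exact: probability_setT.
by have /= -> := integral_cst P measurableT c; rewrite [X in (_ * X)%E]PT mule1.
Qed.

Section DistTo.
Context {R : realType} {d : nat} {N : d.-tuple R -> R} (normN : is_norm N).
Implicit Types (x : d.-tuple R) (G : seq (d.-tuple R)).

Let foldr_min x m b G :
  foldr (fun c m => Num.min (N (vsub x c)) m) (Num.min b m) G =
  Num.min b (foldr (fun c m => Num.min (N (vsub x c)) m) m G).
Proof. by elim: G => //= c G ->; rewrite minCA. Qed.

Lemma dist_to_cons x b G : G != [::] ->
  dist_to N x (b :: G) = Num.min (N (vsub x b)) (dist_to N x G).
Proof. by case: G => // c G _; rewrite /= -!foldr_min minC. Qed.

Lemma dist_to_rcons x b G : G != [::] ->
  dist_to N x (rcons G b) = Num.min (N (vsub x b)) (dist_to N x G).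
Proof. by case: G => // c G _; rewrite /= foldr_rcons foldr_min. Qed.

Lemma first_ptsS (a : nat -> d.-tuple R) n :
  first_pts a n.+1 = rcons (first_pts a n) (a n.+1).
Proof. by rewrite /first_pts -[in LHS](addn1 n) iotaD map_cat cats1 add1n. Qed.

Lemma dist_to_ge0 x G : 0 <= dist_to N x G.
Proof.
case: G => // b G /=; elim: G => [|c G IH] /=; first exact: norm_ge0.
by rewrite le_min IH norm_ge0.
Qed.

Lemma dist_to_first_pts_antitone a x m n : (0 < m <= n)%N ->
  dist_to N x (first_pts a n) <= dist_to N x (first_pts a m).
Proof.
case: m => // m /andP[_]; elim: n => // n IH; rewrite leq_eqVlt => /predU1P[->//|].
rewrite ltnS => mn; apply: le_trans (IH mn); case: n mn {IH} => // n _.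
by rewrite first_ptsS dist_to_rcons// ge_min lexx orbT.
Qed.

Lemma dist_to_first_pts_le a x n : (0 < n)%N ->
  dist_to N x (first_pts a n) <= N (vsub x (a 1)).
Proof. by move=> n0; have /= := @dist_to_first_pts_antitone a x 1 n n0. Qed.

Lemma measurable_dist_to G : measurable_fun [set: d.-tuple R] (dist_to N ^~ G).
Proof.
case: G => [|b G]; first exact: measurable_cst.
elim: G => [|c G IH] /=; first exact: measurable_norm_vsubr.
by apply: measurable_minr => //; exact: measurable_norm_vsubr.
Qed.

Lemma measurable_dist_to_powR G p :
  measurable_fun [set: d.-tuple R] (fun x => ((dist_to N x G) `^ p)%:E).
Proof.
apply/measurable_EFinP.
exact: (measurableT_comp (measurable_powR p) (measurable_dist_to G)).
Qed.

End DistTo.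

(** * One greedy step: averaged gain and decrease of the error *)

Section Greedy.
Context {R : realType} {d : nat} {N : d.-tuple R -> R} (normN : is_norm N).
Variables (P : probability (d.-tuple R) R) (r : R) (a : nat -> d.-tuple R).
Hypotheses (r0 : 0 < r) (greedy : greedy_seq N P r a).

Let D n x := dist_to N x (first_pts a n).

Lemma quant_err_pow p G : 0 < p ->
  (quant_err N P p G `^ p = \int[P]_x ((dist_to N x G) `^ p)%:E)%E.
Proof.
move=> p0; rewrite /quant_err -poweRrM mulVf ?gt_eqF// poweRe1//.
by apply: integral_ge0 => x _; rewrite lee_fin powR_ge0.
Qed.

(** Bounding the distance by twice a maximum, rather than by a sum, gives an inequality between
    powers that holds for every [r > 0], convex or not. *)
Lemma integral_dist_to_lty n : (0 < n)%N -> (\int[P]_x ((N x) `^ r)%:E < +oo)%E ->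
  (\int[P]_x ((D n x) `^ r)%:E < +oo)%E.
Proof.
move=> n0 Nr.
have b x : (D n x) `^ r <= 2 `^ r * ((N x) `^ r + (N (a 1)) `^ r).
  have D0 := dist_to_ge0 normN x (first_pts a n).
  have Dle : D n x <= 2 * Num.max (N x) (N (a 1)).
    rewrite (le_trans (dist_to_first_pts_le a x n0))//.
    rewrite (@le_trans _ _ (N x + N (a 1)))//; last first.
      by rewrite mulr2n mulrDl !mul1r lerD// le_max lexx ?orbT.
    have := norm_vsub_triangle normN (vzero R d) x (a 1).
    rewrite (norm_vsubC normN (vzero R d)).
    have vs0 y : vsub y (vzero R d) = y.
      by apply: eq_from_tnth => i; rewrite !tnth_mktuple subr0.
    by rewrite !vs0.
  have m0 : 0 <= Num.max (N x) (N (a 1)) by rewrite le_max norm_ge0.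
  rewrite (le_trans (ge0_ler_powR (ltW r0) _ _ Dle)) ?nnegrE ?mulr_ge0//.
  rewrite powRM// ler_wpM2l ?powR_ge0//.
  by case: (leP (N x)) => _; rewrite ?lerDl ?lerDr powR_ge0.
have mN : measurable_fun setT (fun x => ((N x) `^ r)%:E).
  apply/measurable_EFinP.
  exact: (measurableT_comp (measurable_powR r) (measurable_norm normN)).
apply: (@le_lt_trans _ _
  (\int[P]_x ((2 `^ r)%:E * (((N x) `^ r)%:E + ((N (a 1)) `^ r)%:E)))%E).
  apply: ge0_le_integral_nomeas => x; first by rewrite lee_fin powR_ge0.
  by rewrite -EFinD -EFinM lee_fin.
rewrite ge0_integralZl//; last 2 first.
- by apply: emeasurable_funD.
- by move=> x _; rewrite -EFinD lee_fin addr_ge0// powR_ge0.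
rewrite ge0_integralD//; last 2 first.
- by move=> x _; rewrite lee_fin powR_ge0.
- by move=> x _; rewrite lee_fin powR_ge0.
rewrite integral_cst_probability lte_mul_pinfty// ?lee_fin ?powR_ge0//.
by rewrite lte_add_pinfty// ltry.
Qed.

Lemma greedy_le n y : (0 < n)%N ->
  (\int[P]_x ((D n.+1 x) `^ r)%:E <=
   \int[P]_x ((Num.min (N (vsub x y)) (D n x)) `^ r)%:E)%E.
Proof.
(* At [n = 0] the distance takes the default value 0 of the empty list, and the right-hand side
   would vanish. *)
case: n => [//|n] _.
have itv0 G : quant_err N P r G \in `[0%E, +oo%E].
  by rewrite in_itv/= poweR_ge0 leey.
have h := gt0_ler_poweR (ltW r0) (itv0 _) (itv0 _) (greedy n.+1 y).
have E G : (quant_err N P r G `^ r = \int[P]_x ((dist_to N x G) `^ r)%:E)%E.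
  exact: quant_err_pow.
(* [greedy_seq] puts the new point in front of the list, [first_pts] at its end; the distance is the
   same. *)
rewrite [leLHS](_ : _ = quant_err N P r (a n.+2 :: first_pts a n.+1) `^ r)%E.
  rewrite [leRHS](_ : _ = quant_err N P r (y :: first_pts a n.+1) `^ r)%E; first exact: h.
  by rewrite E; apply: eq_integral => x _; rewrite dist_to_cons.
rewrite E; apply: eq_integral => x _.
by rewrite /D first_ptsS dist_to_rcons// dist_to_cons.
Qed.

Variables (nu : probability (d.-tuple R) R) (eps : R).
Hypotheses (eps0 : 0 < eps) (eps1 : eps < 1).

(** A lower bound for the gain at [z.1] from adding the point [z.2], written on the product space so
    that Tonelli applies. *)
Let near n (z : d.-tuple R * d.-tuple R) : \bar R :=
  (if N (vsub z.2 z.1) <= eps * D n z.1 then (1 - eps `^ r) * (D n z.1) `^ r else 0)%:E.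

Let epsr_lt1 : eps `^ r < 1.
Proof.
have := gt0_ltr_powR r0 _ _ eps1; rewrite powR1; apply; rewrite nnegrE//.
exact: ltW.
Qed.

Let near_ge0 n z : (0 <= near n z)%E.
Proof.
by rewrite lee_fin; case: ifP => // _; rewrite mulr_ge0 ?powR_ge0// subr_ge0 ltW.
Qed.

Let measurable_near n : measurable_fun setT (near n).
Proof.
apply/measurable_EFinP.
have mD1 : measurable_fun setT (fun z : d.-tuple R * d.-tuple R => D n z.1).
  exact: (measurableT_comp (measurable_dist_to normN _) measurable_fst).
apply: measurable_fun_ifT => //.
- apply: measurable_fun_ler; last exact: measurable_funM.
  rewrite [X in measurable_fun _ X](_ : _ = fun z => N (vsub z.1 z.2)).
    exact: measurable_norm_vsub.
  by apply/funext => z; rewrite norm_vsubC.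
- by apply: measurable_funM => //; apply: (measurableT_comp (measurable_powR r)).
Qed.

Let integral_near n x : (\int[nu]_y near n (x, y) =
  ((1 - eps `^ r) * (D n x) `^ r)%:E * nu (ball_N N x (eps * D n x)))%E.
Proof.
have mB := measurable_ball_N normN x (eps * D n x).
rewrite -[X in nu X]setIT -integral_indic// -ge0_integralZl//.
- apply: eq_integral => y _; rewrite /near indicE /=.
  case: ifP => h; first by rewrite mem_set ?mule1.
  by rewrite memNset ?mule0// /ball_N/= h.
- exact/measurable_EFinP.
- by rewrite lee_fin mulr_ge0 ?powR_ge0// subr_ge0 ltW.
Qed.

(* Averaging the gain of adding the point y over y ~ nu; Tonelli turns the average into
   an integral of nu-masses of balls centred at x. *)
Lemma greedy_gain n : (0 < n)%N ->
  (\int[P]_x ((D n.+1 x) `^ r)%:E +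
   \int[P]_x (((1 - eps `^ r) * (D n x) `^ r)%:E * nu (ball_N N x (eps * D n x))) <=
   \int[P]_x ((D n x) `^ r)%:E)%E.
Proof.
move=> n0; set u1 := (X in (X + _ <= _)%E); set u0 := (X in (_ <= X)%E).
have u1_ge0 : (0 <= u1)%E by apply: integral_ge0 => x _; rewrite lee_fin powR_ge0.
under eq_integral do rewrite -integral_near.
rewrite (fubini_tonelli (near n))//.
have step y : (u1 + \int[P]_x near n (x, y) <= u0)%E.
  apply: (@le_trans _ _
    (\int[P]_x (((Num.min (N (vsub x y)) (D n x)) `^ r)%:E + near n (x, y)))%E).
    rewrite ge0_integralD//.
    - by apply: leeD => //; exact: greedy_le.
    - by move=> x _; rewrite lee_fin powR_ge0.
    - apply/measurable_EFinP; apply: (measurableT_comp (measurable_powR r)).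
      apply: measurable_minr; first exact: measurable_norm_vsubr.
      exact: measurable_dist_to.
    - exact: (measurable_comp _ _ (measurable_near n) (measurable_pair2 y)).
  apply: ge0_le_integral_nomeas => x.
    by rewrite adde_ge0 ?near_ge0// lee_fin powR_ge0.
  have D0 : 0 <= D n x by exact: dist_to_ge0.
  have m0 : 0 <= Num.min (N (vsub x y)) (D n x) by rewrite le_min D0 norm_ge0.
  rewrite -EFinD lee_fin /=; case: ifP => [yx|_]; last first.
    by rewrite addr0 ge0_ler_powR ?(ltW r0) ?nnegrE// ge_min lexx orbT.
  have : (Num.min (N (vsub x y)) (D n x)) `^ r <= (eps * D n x) `^ r.
    rewrite ge0_ler_powR ?(ltW r0) ?nnegrE ?mulr_ge0 ?(ltW eps0)//.
    by rewrite ge_min norm_vsubC// yx.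
  by rewrite (powRM _ (ltW eps0))//; lra.
have mG := measurable_fun_fubini_tonelli_G (m1 := P) (near n) (measurable_near n) (near_ge0 n).
have G0 y : [set: d.-tuple R] y -> (0 <= \int[P]_x near n (x, y))%E.
  by move=> _; exact: integral_ge0.
(* As [nu] has mass 1, [u1] and [u0] are their own averages, so [step] integrates to the claim. The
   inequality stays additive because [u0] may be infinite here. *)
rewrite -[X in (X + _)%E](integral_cst_probability nu u1).
rewrite -(ge0_integralD nu measurableT (fun _ _ => u1_ge0) (measurable_cst u1) G0 mG).
rewrite -[leRHS](integral_cst_probability nu u0).
apply: ge0_le_integral_nomeas => y; last exact: step.
by rewrite adde_ge0// integral_ge0.
Qed.

(** The mass of a ball whose centre and radius vary with [x] is a section integral of [near], and
    Tonelli makes it measurable. *)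
Lemma measurable_nu_ball n : measurable_fun setT
  (fun x => ((1 - eps `^ r) * (D n x) `^ r)%:E * nu (ball_N N x (eps * D n x)))%E.
Proof.
have := measurable_fun_fubini_tonelli_F (m2 := nu) (near n) (measurable_near n) (near_ge0 n).
by apply: eq_measurable_fun => x _; rewrite -integral_near.
Qed.

Variable g : d.-tuple R -> R.
Hypotheses (mg : measurable_fun setT g) (g0 : forall x, 0 <= g x).
Hypothesis nug : forall x, supp N P x ->
  forall t, 0 <= t -> t <= eps * N (vsub x (a 1)) ->
  ((g x * fine (unit_ball_vol N) * t ^+ d)%:E <= nu (ball_N N x t))%E.

Lemma greedy_decrease n : (0 < n)%N -> 0 <= phi_r d r eps ->
  (\int[P]_x ((D n.+1 x) `^ r)%:E +
   (fine (unit_ball_vol N) * phi_r d r eps)%:E *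
     \int[P]_x (g x * (D n x) `^ (d%:R + r))%:E <=
   \int[P]_x ((D n x) `^ r)%:E)%E.
Proof.
move=> n0 phi0; apply: le_trans (greedy_gain n0); rewrite leeD2l//.
have V0 := ltW (unit_ball_vol_gt0 normN).
have mgD : measurable_fun setT (fun x => (g x * (D n x) `^ (d%:R + r))%:E).
  apply/measurable_EFinP; apply: measurable_funM => //.
  exact: (measurableT_comp (measurable_powR _) (measurable_dist_to normN _)).
have gD0 x : 0 <= g x * (D n x) `^ (d%:R + r) by rewrite mulr_ge0 ?powR_ge0.
rewrite -ge0_integralZl//; last 2 first.
- by move=> x _; rewrite lee_fin.
- by rewrite lee_fin mulr_ge0.
apply: ae_ge0_le_integral => //.
- move=> x _; rewrite -EFinM lee_fin.
  exact: mulr_ge0 (mulr_ge0 V0 phi0) (gD0 x).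
- exact: measurable_funeM.
- by move=> x _; rewrite mule_ge0// lee_fin mulr_ge0 ?powR_ge0// subr_ge0 ltW.
- exact: measurable_nu_ball.
(* The lower bound on ball masses is assumed on the support only; the complement is null. *)
apply: (negligibleS _ (negligible_suppC normN P)) => x /= + sx; apply => _.
have D0 : 0 <= D n x by exact: dist_to_ge0.
have := nug sx (mulr_ge0 (ltW eps0) D0).
(* The radius [eps * D n x] is admissible: [a 1] is among the points, so [D n x] is at most the
   distance to it. *)
rewrite ler_pM2l// => /(_ (dist_to_first_pts_le a x n0)) nuB.
have c0 : (0 <= ((1 - eps `^ r) * D n x `^ r)%:E)%E.
  by rewrite lee_fin mulr_ge0 ?powR_ge0// subr_ge0 ltW.
apply: le_trans (lee_wpmul2l c0 nuB).
rewrite -!EFinM lee_fin.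
rewrite powRD; last by rewrite gt_eqF// ltr_wpDl.
rewrite powR_mulrn// /phi_r exprMn.
set V := fine _ in V0 *; set Dr := D n x `^ r; set Dd := D n x ^+ d.
rewrite [leLHS](_ : _ = (3 `^ (- r) - eps `^ r) * (V * eps ^+ d * g x * Dd * Dr));
  last by ring.
rewrite [leRHS](_ : _ = (1 - eps `^ r) * (V * eps ^+ d * g x * Dd * Dr));
  last by ring.
apply: ler_wpM2r.
  by rewrite !mulr_ge0 ?powR_ge0 ?exprn_ge0 ?(ltW eps0).
(* The factor 1 - eps^r is weakened to the 3^(-r) - eps^r of [phi_r]. *)
rewrite lerD2r powRN invf_le1 ?powR_gt0//.
have h13 : 1 <= 3 :> R by rewrite ler1n.
by have := ge0_ler_powR (ltW r0) _ _ h13; rewrite powR1; apply; rewrite nnegrE.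
Qed.

End Greedy.

(** * Negative powers and the weighted Hoelder inequality *)

Section NegPow.
Context {R : realType}.
Implicit Types (x c : R).

Lemma neg_pow_gt0 x c : 0 <= x -> (0 < neg_pow x c)%E.
Proof.
move=> x0; rewrite /neg_pow; case: ifPn => // xn.
by rewrite lte_fin powR_gt0// lt_neqAle eq_sym xn.
Qed.

Lemma neg_pow_ge0 x c : (0 <= neg_pow x c)%E.
Proof. by rewrite /neg_pow; case: ifP => // _; rewrite lee_fin powR_ge0. Qed.

Lemma measurable_neg_pow c : measurable_fun [set: R] (fun x => neg_pow x c).
Proof.
apply: measurable_fun_ifT => //; first exact: measurable_fun_eqr.
by apply/measurable_EFinP.
Qed.

End NegPow.

(* Hoelder's inequality for the factorisation
   D^p = (w D^q)^(p/q) * w^(-p/q), the conjugate exponents being q/p and q/(q-p). *)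
Lemma weighted_hoelder (disp : measure_display) (T : measurableType disp)
  (R : realType) (mu : {measure set T -> \bar R}) (D w : T -> R) (p q : R) :
  0 < p -> p < q ->
  measurable_fun setT D -> measurable_fun setT w ->
  (forall x, 0 <= D x) -> (forall x, 0 <= w x) ->
  (\int[mu]_x neg_pow (w x) (p / (q - p)) < +oo)%E ->
  (\int[mu]_x ((D x) `^ p)%:E <=
   (\int[mu]_x (w x * (D x) `^ q)%:E) `^ (p / q) *
   (\int[mu]_x neg_pow (w x) (p / (q - p))) `^ ((q - p) / q))%E.
Proof.
move=> p0 pq mD mw D0 w0 Ifin.
have q0 : 0 < q by lra.
have qp0 : 0 < q - p by lra.
have qn0 : q != 0 by rewrite gt_eqF.
have pn0 : p != 0 by rewrite gt_eqF.
have qpn0 : q - p != 0 by rewrite gt_eqF.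
have mnp : measurable_fun setT (fun x => neg_pow (w x) (p / (q - p))).
  exact: (measurableT_comp (measurable_neg_pow _) mw).
pose f x := (w x * (D x) `^ q) `^ (p / q).
pose h x := (w x) `^ (- (p / q)).
have mwD : measurable_fun setT (fun x => w x * (D x) `^ q).
  by apply: measurable_funM => //; exact: (measurableT_comp (measurable_powR q) mD).
have mf : measurable_fun setT f by exact: (measurableT_comp (measurable_powR _) mwD).
have mh : measurable_fun setT h by exact: (measurableT_comp (measurable_powR _) mw).
have wD0 x : 0 <= w x * (D x) `^ q by rewrite mulr_ge0 ?powR_ge0.
have fh0 x : 0 <= f x * h x by rewrite mulr_ge0 ?powR_ge0.
have := @hoelder _ _ _ mu f h (q / p) (q / (q - p)) mf mh.
rewrite !divr_gt0// => /(_ isT isT).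
have -> : (q / p)^-1 + (q / (q - p))^-1 = 1 by field; rewrite pn0 qpn0 qn0.
move=> /(_ erefl); rewrite Lnorm1.
have -> : (\int[mu]_x `|(EFin \o (f \* h)%R) x| = \int[mu]_x ((D x) `^ p)%:E)%E.
  transitivity (\int[mu]_x (f x * h x)%:E)%E.
    by apply: eq_integral => x _; rewrite /= ger0_norm.
  apply: ge0_ae_eq_integral => //.
  - by apply/measurable_EFinP; exact: measurable_funM.
  - by apply/measurable_EFinP; exact: (measurableT_comp (measurable_powR p) mD).
  - by move=> x _; rewrite lee_fin.
  - by move=> x _; rewrite lee_fin powR_ge0.
  (* The factorisation can fail where [w] vanishes, but there [neg_pow] is infinite, so
     integrability makes this set null. *)
  have inp : mu.-integrable setT (fun x => neg_pow (w x) (p / (q - p))).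
    apply/integrableP; split => //.
    by under eq_integral do rewrite gee0_abs ?neg_pow_ge0//.
  have := integrable_ae measurableT inp; apply: filterS => x /(_ I) + _.
  rewrite /neg_pow; case: ifPn => // wn0 _.
  rewrite /f /h powRM ?powR_ge0// -powRrM mulrCA mulfV// mulr1.
  by rewrite mulrAC powRN mulfV ?mul1r// powR_eq0 negb_and wn0.
move=> /le_trans; apply; rewrite unlock; apply: lee_pmul; rewrite ?poweR_ge0//.
  rewrite le_eqVlt; apply/orP; left; apply/eqP; rewrite invf_div; congr (_ `^ _)%E.
  apply: eq_integral => x _; rewrite /= ger0_norm ?powR_ge0// -powRrM.
  by rewrite (_ : p / q * (q / p) = 1) ?powRr1//; field; rewrite pn0 qn0.
rewrite invf_div; apply: gt0_ler_poweR.
- by rewrite divr_ge0// ltW.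
- rewrite in_itv/= leey andbT; by apply: integral_ge0 => x _; rewrite lee_fin powR_ge0.
- rewrite in_itv/= leey andbT; apply: integral_ge0 => x _; exact: neg_pow_ge0.
(* Only an inequality is available: where [w] vanishes, the power of [h] is 0 by convention while
   [neg_pow] is [+oo]. *)
apply: ge0_le_integral => //.
- by move=> x _; exact: poweR_ge0.
- under eq_fun do rewrite /= .
  apply/measurable_EFinP; apply: (measurableT_comp (measurable_powR _)).
  exact: measurableT_comp.
move=> x _; rewrite /= ger0_norm ?powR_ge0// -powRrM /neg_pow.
case: ifPn => // _; rewrite ?leey// lee_fin.
by rewrite (_ : - (p / q) * (q / (q - p)) = - (p / (q - p)))//; field; rewrite qpn0 qn0.
Qed.

(** * Decay of a sequence under a power recursion *)

Section RealSequences.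
Context {R : realType}.

(* Tangent line of the convex function u^(-al) at u, through exp y >= 1 + y and
   ln y <= y - 1. *)
Lemma powRN_tangent (u v al : R) : 0 < v -> v <= u -> 0 < al ->
  u `^ (- al) + al * u `^ (- al - 1) * (u - v) <= v `^ (- al).
Proof.
move=> v0 vu al0; have u0 := lt_le_trans v0 vu.
have ln_vu : ln (v / u) <= v / u - 1.
  have := @le_ln1Dx R (v / u - 1); rewrite addrCA subrr addr0; apply.
  by rewrite ltrBrDl subrr divr_gt0.
have -> : v `^ (- al) = u `^ (- al) * expR (- al * ln (v / u)).
  rewrite -{1}(divfK (lt0r_neq0 u0) v) powRM ?(ltW u0) ?divr_ge0 ?ltW// mulrC.
  by congr (_ * _); rewrite /powR gt_eqF// divr_gt0.
have -> : u `^ (- al - 1) = u `^ (- al) / u.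
  by rewrite powRB ?powRr1 ?ltW// (gt_eqF u0) implybT.
rewrite [leLHS](_ : _ = u `^ (- al) * (1 + - al * (v / u - 1))); last by field; rewrite gt_eqF.
rewrite ler_wpM2l ?powR_ge0// (le_trans _ (expR_ge1Dx _))// lerD2l.
by rewrite !mulNr lerN2 ler_pM2l.
Qed.

(** This is the discrete form of u' = -c u^(1+al): by the tangent inequality, u^(-al) grows by at
    least [al * c] at each step. *)
Lemma power_recursion_bound (u : nat -> R) (c al : R) : 0 < c -> 0 < al ->
  (forall k, 0 <= u k) ->
  (forall k, u k.+1 + c * u k `^ (1 + al) <= u k) ->
  forall m, (0 < m)%N -> u m <= (al * c * m%:R) `^ (- al^-1).
Proof.
move=> c0 al0 u0 rec m m0.
have [um0|um0] := eqVneq (u m) 0; first by rewrite um0 powR_ge0.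
have ump : 0 < u m by rewrite lt_neqAle eq_sym um0 u0.
have mono k : u k.+1 <= u k.
  by apply: le_trans (rec k); rewrite lerDl mulr_ge0 ?powR_ge0 ?ltW.
(* Positivity of [u m] passes back to all earlier indices, so the negative powers below are
   genuine. *)
have up k : (k <= m)%N -> 0 < u k.
  move=> km; apply: (lt_le_trans ump).
  by rewrite -(subnK km); elim: (m - k)%N => // j; apply: le_trans; exact: mono.
have low k : (k <= m)%N -> al * c * k%:R <= u k `^ (- al).
  elim: k => [_|k IH km]; first by rewrite mulr0 powR_ge0.
  apply: le_trans (powRN_tangent (up _ km) (mono k) al0).
  rewrite -natr1 mulrDr mulr1 lerD ?IH ?(ltnW km)//.
  rewrite -mulrA ler_pM2l//; have uk := up _ (ltnW km).
  have h : c * u k `^ (1 + al) <= u k - u k.+1 by have := rec k; lra.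
  apply: le_trans (ler_wpM2l (powR_ge0 _ _) h).
  rewrite mulrCA -powRD ?(gt_eqF uk) ?implybT//.
  by rewrite (_ : - al - 1 + (1 + al) = 0) ?powRr0 ?mulr1//; ring.
have -> : u m = (u m `^ (- al)) `^ (- al^-1).
  by rewrite -powRrM mulrNN mulfV ?gt_eqF// powRr1// ltW.
rewrite !powRN lef_pV2 ?posrE ?powR_gt0 ?mulr_gt0 ?ltr0n ?invr_gt0 ?powR_gt0//.
rewrite ge0_ler_powR ?invr_ge0 ?(ltW al0)// ?nnegrE ?invr_ge0 ?powR_ge0
  ?mulr_ge0 ?(ltW al0) ?(ltW c0)//.
by rewrite -powRN low.
Qed.

End RealSequences.

(** * From extended integrals to inequalities between reals *)

Lemma integral_neg_pow_gt0 (disp : measure_display) (T : measurableType disp)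
  (R : realType) (P : probability T R) (w : T -> R) (c : R) :
  measurable_fun setT w -> (forall x, 0 <= w x) ->
  (0 < \int[P]_x neg_pow (w x) c)%E.
Proof.
move=> mw w0; have mnp : measurable_fun setT (fun x => neg_pow (w x) c).
  exact: (measurableT_comp (measurable_neg_pow _) mw).
rewrite lt0e integral_ge0 ?andbT; last by move=> x _; exact: neg_pow_ge0.
apply/negP => /eqP I0.
have /(ae_eq_integral_abs P measurableT mnp) : (\int[P]_x `|neg_pow (w x) c| = 0)%E.
  by rewrite -[RHS]I0; apply: eq_integral => x _; rewrite gee0_abs// neg_pow_ge0.
move=> [A [mA PA sub]].
(* [neg_pow] is positive everywhere, so the null set [A] off which it vanishes must be the whole
   space. *)
have AT : A = setT.
  apply/seteqP; split => // x _; apply: sub => /= /(_ I) wx.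
  by have := neg_pow_gt0 c (w0 x); rewrite wx ltxx.
have PT : P A = 1%E by rewrite AT; exact: probability_setT.
by move: PT; rewrite PA => /esym/eqP; rewrite onee_eq0.
Qed.

(** Hoelder's inequality raised to the power [q / p] and solved for the weighted integral. The first
    conclusion is what makes the integral of the [s]-th power finite when only the moment of order
    [r] is assumed. *)
Lemma weighted_hoelder_fine (disp : measure_display) (T : measurableType disp)
  (R : realType) (mu : {measure set T -> \bar R}) (D w : T -> R) (p q : R) :
  0 < p -> p < q ->
  measurable_fun setT D -> measurable_fun setT w ->
  (forall x, 0 <= D x) -> (forall x, 0 <= w x) ->
  (0 < \int[mu]_x neg_pow (w x) (p / (q - p)) < +oo)%E ->
  (\int[mu]_x (w x * (D x) `^ q)%:E < +oo)%E ->
  (\int[mu]_x ((D x) `^ p)%:E < +oo)%E /\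
  fine (\int[mu]_x neg_pow (w x) (p / (q - p))) `^ (- ((q - p) / p)) *
  fine (\int[mu]_x ((D x) `^ p)%:E) `^ (q / p) <=
  fine (\int[mu]_x (w x * (D x) `^ q)%:E).
Proof.
move=> p0 pq mD mw D0 w0 /andP[I0 Ioo] Joo.
have := weighted_hoelder p0 pq mD mw D0 w0 Ioo.
have E0 : (0 <= \int[mu]_x ((D x) `^ p)%:E)%E.
  by apply: integral_ge0 => x _; rewrite lee_fin powR_ge0.
have J0 : (0 <= \int[mu]_x (w x * (D x) `^ q)%:E)%E.
  by apply: integral_ge0 => x _; rewrite lee_fin mulr_ge0 ?powR_ge0.
move: E0 J0 Joo I0 Ioo.
move: (\int[mu]_x neg_pow _ _)%E (\int[mu]_x (_ * _)%:E)%E (\int[mu]_x _)%E.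
move=> [i| |] [j| |] [e| |]// e0 j0 _ i0 _.
move: e0 j0 i0; rewrite !poweR_EFin -EFinM !lee_fin lte_fin => e0 j0 i0 ej.
split; rewrite ?ltry//=.
have q0 : 0 < q by lra.
have qpn0 : q - p != 0 by rewrite subr_eq0 gt_eqF.
have qn0 : q != 0 by rewrite gt_eqF.
have pn0 : p != 0 by rewrite gt_eqF.
have ij0 : 0 <= j `^ (p / q) * i `^ ((q - p) / q) by rewrite mulr_ge0 ?powR_ge0.
have := ge0_ler_powR (ltW (divr_gt0 q0 p0)) e0 ij0 ej.
rewrite powRM ?powR_ge0// -!powRrM (_ : p / q * (q / p) = 1); last by field; rewrite pn0 qn0.
rewrite (_ : (q - p) / q * (q / p) = (q - p) / p); last by field; rewrite pn0 qn0.
rewrite powRr1// => h.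
by rewrite powRN mulrC ler_pdivrMr// powR_gt0.
Qed.

(* In logarithms, the conclusion is the hypothesis divided by dd + r. *)
Lemma solve_midpoint_bound (R : realType) (e is_ ir V ph h r s dd : R) :
  0 < e -> 0 < is_ -> 0 < ir -> 0 < V -> 0 < ph -> 0 < h -> 0 < r -> 0 < s -> 0 < dd ->
  h * (V * ph * (is_ `^ (- ((dd + r - s) / s)) * e `^ ((dd + r) / s))) <=
    (dd / r * (V * ph * ir `^ (- (dd / r))) * h) `^ (- (dd / r)^-1) ->
  e `^ s^-1 <= 2 `^ dd^-1 * (r / dd) `^ (r / (dd * (dd + r))) * V `^ (- dd^-1)
    * ph `^ (- dd^-1) * is_ `^ ((dd + r - s) / (s * (dd + r))) * ir `^ ((dd + r)^-1)
    * (2 * h) `^ (- dd^-1).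
Proof.
move=> e0 is0 ir0 V0 ph0 h0 r0 s0 d0.
have q0 : 0 < dd + r by lra.
have dr0 : 0 < dd / r by rewrite divr_gt0.
have rd0 : 0 < r / dd by rewrite divr_gt0.
have di0 : 0 < dd^-1 by rewrite invr_gt0.
have ri0 : 0 < r^-1 by rewrite invr_gt0.
rewrite -ler_ln ?posrE ?mulr_gt0 ?powR_gt0 ?mulr_gt0 ?powR_gt0//.
rewrite -[in X in _ -> X]ler_ln ?posrE ?mulr_gt0 ?powR_gt0 ?mulr_gt0 ?powR_gt0//.
rewrite !(lnM, lnV, ln_powR) ?posrE ?invr_gt0 ?mulr_gt0 ?powR_gt0 ?mulr_gt0 ?powR_gt0//.
move: (ln e) (ln is_) (ln ir) (ln V) (ln ph) (ln h) (ln dd) (ln r) (ln 2).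
move=> le li lr lV lp lh ld lr' l2 H.
have := ler_wpM2l (ltW (divr_gt0 ltr01 q0)) H; rewrite -subr_ge0 => H'.
rewrite -subr_ge0; apply: (le_trans H'); rewrite le_eqVlt; apply/orP; left; apply/eqP.
by field; rewrite !gt_eqF.
Qed.

Lemma phi_r_gt0 (R : realType) (d : nat) (r eps : R) :
  0 < r -> 0 < eps -> eps < 3^-1 -> 0 < phi_r d r eps.
Proof.
move=> r0 eps0 eps3; rewrite /phi_r mulr_gt0 ?exprn_gt0// subr_gt0.
rewrite -[- r]mulN1r powRrM powR_inv1//.
by rewrite gt0_ltr_powR// nnegrE ?(ltW eps0) ?invr_ge0.
Qed.

Lemma sum_telescope_le (R : realType) (u : nat -> R) (X : R) (m n : nat) :
  (forall k, (m <= k < n)%N -> X <= u k - u k.+1) -> 0 <= u n -> (m <= n)%N ->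
  (n - m)%:R * X <= u m.
Proof.
move=> Xu un mn; apply: (@le_trans _ _ (u m - u n)); last by rewrite lerBlDr lerDl.
rewrite -opprB -(telescope_sumr u mn) -sumrN mulr_natl -sumr_const_nat.
by rewrite !big_nat; apply: ler_sum => k kmn; rewrite opprB Xu.
Qed.

(** Both halves [m] and [n - m] of the index range have at least [(n.+1 - 2) / 2] elements; with
    [n.+1] points, this is the origin of the shift by 2 in the rate. *)
Lemma half_bounds n : (2 <= n)%N ->
  let m := (n %/ 2)%N in
  [/\ (0 < m)%N, (m <= n)%N, (n.+1 <= m * 2 + 2)%N & (n.+1 <= (n - m) * 2 + 2)%N].
Proof. by move=> n2 m; rewrite /m; split; lia. Qed.

(** * The rate when both integrals of negative powers are finite *)

Section Rate.
Context {R : realType} {d : nat} {N : d.-tuple R -> R} (normN : is_norm N).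
Variables (P nu : probability (d.-tuple R) R) (r s eps : R) (a : nat -> d.-tuple R).
Variable g : d.-tuple R -> R.
Hypotheses (d1 : (1 <= d)%N) (r0 : 0 < r) (rs : r < s) (sq : s < d%:R + r).
Hypothesis Nr : (\int[P]_x ((N x) `^ r)%:E < +oo)%E.
Hypothesis greedy : greedy_seq N P r a.
Hypotheses (eps0 : 0 < eps) (eps3 : eps < 3^-1).
Hypotheses (mg : measurable_fun setT g) (g0 : forall x, 0 <= g x).
Hypothesis nug : forall x, supp N P x ->
  forall t, 0 <= t -> t <= eps * N (vsub x (a 1)) ->
  ((g x * fine (unit_ball_vol N) * t ^+ d)%:E <= nu (ball_N N x t))%E.

Let Is := (\int[P]_x neg_pow (g x) (s / (d%:R + r - s)))%E.
Let Ir := (\int[P]_x neg_pow (g x) (r / d%:R))%E.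
Hypotheses (Isoo : (Is < +oo)%E) (Iroo : (Ir < +oo)%E).

(** The index is shifted by one so that the list of points is nonempty already at [k = 0]. *)
Let D k x := dist_to N x (first_pts a k.+1).
Let u k := fine (\int[P]_x ((D k x) `^ r)%:E).
Let e k := fine (\int[P]_x ((D k x) `^ s)%:E).
Let j k := fine (\int[P]_x (g x * (D k x) `^ (d%:R + r))%:E).
Let C := fine (unit_ball_vol N) * phi_r d r eps.

Let d0 : 0 < d%:R :> R. Proof. by rewrite ltr0n. Qed.
Let s0 : 0 < s. Proof. exact: lt_trans rs. Qed.
Let C0 : 0 < C.
Proof. by rewrite mulr_gt0 ?unit_ball_vol_gt0 ?phi_r_gt0. Qed.
Let mD k : measurable_fun setT (D k). Proof. exact: measurable_dist_to. Qed.
Let D0 k x : 0 <= D k x. Proof. exact: dist_to_ge0. Qed.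
Let Is0 : (0 < Is)%E. Proof. exact: integral_neg_pow_gt0. Qed.
Let Ir0 : (0 < Ir)%E. Proof. exact: integral_neg_pow_gt0. Qed.

Let integral_ge0_powR k p : (0 <= \int[P]_x ((D k x) `^ p)%:E)%E.
Proof. by apply: integral_ge0 => x _; rewrite lee_fin powR_ge0. Qed.

Let u_fin k : (\int[P]_x ((D k x) `^ r)%:E)%E = (u k)%:E.
Proof.
rewrite fineK// ge0_fin_numE//.
exact: (integral_dist_to_lty normN a r0 (ltn0Sn k) Nr).
Qed.

(** Since [u k] is finite and [C] is positive, the decrease itself forces the weighted integral to
    be finite. *)
Let decrease k : (\int[P]_x (g x * (D k x) `^ (d%:R + r))%:E < +oo)%E /\
  u k.+1 + C * j k <= u k.
Proof.
have eps1 : eps < 1 by move: eps3; lra.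
have := greedy_decrease normN r0 greedy eps0 eps1 mg g0 nug (ltn0Sn k)
  (ltW (phi_r_gt0 d r0 eps0 eps3)).
rewrite -/C -/(D k) (u_fin k) -/(D k.+1) (u_fin k.+1) /j.
have : (0 <= \int[P]_x (g x * (D k x) `^ (d%:R + r))%:E)%E.
  by apply: integral_ge0 => x _; rewrite lee_fin mulr_ge0 ?powR_ge0.
move: (\int[P]_x _)%E => [y _| _|//]; last by rewrite gt0_muley ?lte_fin.
by rewrite -EFinM -EFinD lee_fin ltry.
Qed.

Let hoelder_r k : fine Ir `^ (- (d%:R / r)) * u k `^ (1 + d%:R / r) <= j k.
Proof.
have qr : r < d%:R + r by rewrite ltrDr.
have Er : d%:R + r - r = d%:R by rewrite addrK.
have := weighted_hoelder_fine r0 qr (mD k) mg (D0 k) g0 (mu := P).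
rewrite Er => /(_ _ (proj1 (decrease k)))[]; first by apply/andP.
by rewrite (_ : (d%:R + r) / r = 1 + d%:R / r)//; field; rewrite gt_eqF.
Qed.

Let hoelder_s k : (\int[P]_x ((D k x) `^ s)%:E < +oo)%E /\
  fine Is `^ (- ((d%:R + r - s) / s)) * e k `^ ((d%:R + r) / s) <= j k.
Proof.
apply: (weighted_hoelder_fine s0 sq (mD k) mg (D0 k) g0 _ (proj1 (decrease k))).
exact/andP.
Qed.

Let e_antitone m n : (m <= n)%N -> e n <= e m.
Proof.
move=> mn; apply: fine_le; rewrite ?ge0_fin_numE// ?(proj1 (hoelder_s _))//.
apply: ge0_le_integral_nomeas => x; first by rewrite lee_fin powR_ge0.
by rewrite lee_fin ge0_ler_powR ?nnegrE ?(ltW s0)// dist_to_first_pts_antitone.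
Qed.

Lemma greedy_rate n : (3 <= n)%N ->
  (quant_err N P s (first_pts a n) <=
   (kappa_greedy N r eps * fine Is `^ ((d%:R + r - s) / (s * (d%:R + r)))
    * fine Ir `^ ((d%:R + r)^-1) * (n%:R - 2) `^ (- d%:R^-1))%:E)%E.
Proof.
case: n => // n n2.
have -> : quant_err N P s (first_pts a n.+1) = (e n `^ s^-1)%:E.
  rewrite /quant_err -[X in (X `^ _)%E]fineK ?poweR_EFin//.
  by rewrite ge0_fin_numE; [exact: (proj1 (hoelder_s n))|exact: integral_ge0_powR].
rewrite lee_fin; have en0 : 0 <= e n by exact: fine_ge0 (integral_ge0_powR n s).
(* A zero error is set aside because [solve_midpoint_bound] takes the logarithm of [e n]. *)
have [->|en] := eqVneq (e n) 0.
  by rewrite powR0 ?invr_eq0 ?gt_eqF// !mulr_ge0 ?powR_ge0.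
have {en0 en}e0 : 0 < e n by rewrite lt_neqAle eq_sym en.
have is0 : 0 < fine Is by rewrite fine_gt0// Is0.
have ir0 : 0 < fine Ir by rewrite fine_gt0// Ir0.
set h := (n.+1%:R - 2) / 2 : R.
have h0 : 0 < h by rewrite divr_gt0// subr_gt0 ltr_nat.
have -> : n.+1%:R - 2 = 2 * h by rewrite /h; field.
apply: solve_midpoint_bound => //; rewrite ?unit_ball_vol_gt0 ?phi_r_gt0// -/C.
have al0 : 0 < d%:R / r by rewrite divr_gt0.
have c0 : 0 < C * fine Ir `^ (- (d%:R / r)) by rewrite mulr_gt0 ?powR_gt0.
have u0 k : 0 <= u k by exact: fine_ge0 (integral_ge0_powR k r).
(* The recursion bounds [u m] through the first [m] steps; the decreases are summed over the
   remaining [n - m]. *)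
pose m := (n %/ 2)%N.
have [m0 mn m2 nm2] := half_bounds n2.
have hm : h <= m%:R by rewrite /h ler_pdivrMr// lerBlDr -natrM -natrD ler_nat.
have hnm : h <= (n - m)%:R by rewrite /h ler_pdivrMr// lerBlDr -natrM -natrD ler_nat.
have um := @power_recursion_bound R u _ _ c0 al0 u0 _ m m0.
apply: (@le_trans _ _ (u m)); last first.
  apply: (le_trans (um _)) => [k|].
    apply: le_trans (proj2 (decrease k)); by rewrite lerD2l -mulrA ler_pM2l.
  have alc0 : 0 < d%:R / r * (C * fine Ir `^ (- (d%:R / r))) by exact: mulr_gt0.
  have alch0 := mulr_gt0 alc0 h0.
  have alcm0 := mulr_gt0 alc0 (lt_le_trans h0 hm).
  (* The exponent is negative, so replacing [m] by the smaller [h] enlarges the bound. *)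
  rewrite !(powRN _ (d%:R / r)^-1) lef_pV2 ?posrE; last 2 first.
  - exact: powR_gt0.
  - exact: powR_gt0.
  apply: ge0_ler_powR; rewrite ?nnegrE ?(ltW alch0) ?(ltW alcm0) ?invr_ge0 ?(ltW al0)//.
  exact: ler_wpM2l (ltW alc0) _ _ hm.
(* [X] bounds from below the decrease of [u] at every [k] with [m <= k < n], because [e k] is at
   least [e n] there. *)
set X := (X in h * X <= _).
have X0 : 0 <= X by exact: mulr_ge0 (ltW C0) (mulr_ge0 (powR_ge0 _ _) (powR_ge0 _ _)).
apply: (le_trans (ler_wpM2r X0 hnm)).
apply: (sum_telescope_le _ (u0 n) mn) => k /andP[_ kn].
have [_ dec] := decrease k; have [_ hs] := hoelder_s k.
have ek : e n `^ ((d%:R + r) / s) <= e k `^ ((d%:R + r) / s).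
  apply: (ge0_ler_powR _ _ _ (e_antitone (ltnW kn))).
  - by rewrite divr_ge0// ltW// (lt_trans s0).
  - exact: fine_ge0 (integral_ge0_powR n s).
  - exact: fine_ge0 (integral_ge0_powR k s).
have Xj : X <= C * j k.
  rewrite (ler_pM2l C0); apply: (le_trans _ hs).
  exact: ler_wpM2l (powR_ge0 _ _) _ _ ek.
by rewrite lerBrDl; apply: (le_trans _ dec); rewrite lerD2l.
Qed.

End Rate.

(** * The bound in extended reals, infinite integrals included *)

Theorem theorem3p1 (R : realType) (d : nat) (r : R) (N : d.-tuple R -> R)
  (P : probability (d.-tuple R) R) (s : R) (a : nat -> d.-tuple R)
  (eps : R) (nu : probability (d.-tuple R) R) (g : d.-tuple R -> R) :
  (1 <= d)%N -> 0 < r -> is_norm N ->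
  (\int[P]_x ((N x) `^ r)%:E < +oo)%E ->
  r < s -> s < d%:R + r ->
  greedy_seq N P r a ->
  0 < eps -> eps < 3^-1 ->
  measurable_fun setT g -> (forall x, 0 <= g x) ->
  (forall x, supp N P x -> forall t, 0 <= t -> t <= eps * N (vsub x (a 1%N)) ->
     ((g x * fine (unit_ball_vol N) * t ^+ d)%:E <= nu (ball_N N x t))%E) ->
  forall n : nat, (3 <= n)%N ->
  (quant_err N P s (first_pts a n) <=
     (kappa_greedy N r eps)%:E
     * (\int[P]_x neg_pow (g x) (s / (d%:R + r - s))) `^ ((d%:R + r - s) / (s * (d%:R + r)))
     * (\int[P]_x neg_pow (g x) (r / d%:R)) `^ ((d%:R + r)^-1)
     * ((n%:R - 2) `^ (- d%:R^-1))%:E)%E.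
Proof.
move=> d1 r0 normN Nr rs sq greedy eps0 eps3 mg g0 nug n n3.
have kap0 : 0 < kappa_greedy N r eps.
  have d0 : 0 < d%:R :> R by rewrite ltr0n.
  by rewrite /kappa_greedy !mulr_gt0 ?powR_gt0 ?unit_ball_vol_gt0 ?phi_r_gt0 ?divr_gt0.
have n20 : 0 < (n%:R - 2) `^ (- d%:R^-1) :> R by rewrite powR_gt0// subr_gt0 ltr_nat.
have s0 : 0 < s by exact: lt_trans rs.
have q0 : 0 < d%:R + r by exact: lt_trans sq.
have es : (d%:R + r - s) / (s * (d%:R + r)) != 0.
  by rewrite gt_eqF// divr_gt0 ?mulr_gt0// subr_gt0.
have er : (d%:R + r)^-1 != 0 by rewrite invr_eq0 gt_eqF.
have Is0 := integral_neg_pow_gt0 P (s / (d%:R + r - s)) mg g0.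
have Ir0 := integral_neg_pow_gt0 P (r / d%:R) mg g0.
have rate := @greedy_rate R d N normN P nu r s eps a g d1
  r0 rs sq Nr greedy eps0 eps3 mg g0 nug.
move: Is0 Ir0 rate.
move: (\int[P]_x neg_pow (g x) (s / (d%:R + r - s)))%E
  (\int[P]_x neg_pow (g x) (r / d%:R))%E => Is Ir Is0 Ir0 /(_ _ _ _ n3) rate.
(* If either integral is infinite, the right-hand side is [+oo]: every other factor is positive, so
   no product of 0 and [+oo] arises. *)
have [Isoo|Isoo] := eqVneq Is +oo%E.
  rewrite Isoo (poweRyr es) gt0_muley ?lte_fin// gt0_mulye ?poweR_gt0//.
  by rewrite gt0_mulye ?lte_fin ?leey.
have [Iroo|Iroo] := eqVneq Ir +oo%E.
  rewrite Iroo (poweRyr er) gt0_muley ?gt0_mulye ?lte_fin ?leey//.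
  by rewrite mule_gt0 ?lte_fin ?poweR_gt0.
have Isf : Is \is a fin_num by rewrite gt0_fin_numE// ltey.
have Irf : Ir \is a fin_num by rewrite gt0_fin_numE// ltey.
rewrite -(fineK Isf) -(fineK Irf) !poweR_EFin -!EFinM.
by apply: rate; rewrite ltey.
Qed.
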